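(* Let $d\in\mathbb{N}$ and let $X$ be a random vector, defined on a probability space $(\Omega,\Sigma,\mathbb{P})$ and taking values in $\mathbb{R}^d$, such that $\|X\|_2\le 1$ almost surely. Then for any $r\in\mathbb{N}$ there exists a partition of the sample space $\Omega$ into at most $2^r$ (measurable) parts such that, for the $\sigma$-algebra $\mathcal{F}$ generated by this partition, the conditional expectation $Y=\mathbb{E}[X\mid\mathcal{F}]$ satisfies $$\left\|\mathbb{E}\,XX^{\mathsf T}-\mathbb{E}\,YY^{\mathsf T}\right\|_F\le\frac{\pi}{\sqrt r}.$$
   Context: $\mathbb{N}=\{1,2,3,\dots\}$. $\|\cdot\|_2$ is the Euclidean norm on $\mathbb{R}^d$. For real $d\times d$ matrices $A,B$, $\langle A,B\rangle=\mathrm{Tr}(AB^{\mathsf T})$ and $\|A\|_F=\sqrt{\langle A,A\rangle}$ is the Frobenius norm. Expectations of random vectors and matrices are taken entrywise. *)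

(* Defs.v *)
From HB Require Import structures.
From mathcomp Require Import all_boot all_order all_algebra.
From mathcomp Require Import all_classical all_reals all_analysis.

Set Implicit Arguments.
Unset Strict Implicit.
Unset Printing Implicit Defensive.

Import Order.TTheory GRing.Theory Num.Theory.
Import numFieldNormedType.Exports.

Local Open Scope classical_set_scope.
Local Open Scope ring_scope.

Definition norm2 (R : realType) (n : nat) (x : 'cV[R]_n) : R :=
  Num.sqrt (\sum_(i < n) x i 0 ^+ 2).

Definition mxdot (R : realType) (n : nat) (A B : 'M[R]_n) : R :=
  \tr (A *m B^T).

Definition normF (R : realType) (n : nat) (A : 'M[R]_n) : R :=
  Num.sqrt (mxdot A A).

(* The Borel sigma-algebra of R^n is the product one, so measurability of a
   random vector is measurability of its coordinates. *)
Definition random_vector (d : measure_display) (T : measurableType d)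
    (R : realType) (n : nat) (X : T -> 'cV[R]_n) : Prop :=
  forall i : 'I_n, measurable_fun [set: T] (fun w => X w i 0).

(* 'E_P[_] is extended-real valued; [fine] is harmless as long as the entries
   are integrable. *)
Definition mxexpectation (d : measure_display) (T : measurableType d)
    (R : realType) (P : probability T R) (m n : nat)
    (M : T -> 'M[R]_(m, n)) : 'M[R]_(m, n) :=
  \matrix_(i, j) fine ('E_P[fun w => M w i j])%E.

(* Y is a version of E[X | F], for a sub-sigma-algebra F of T. *)
Definition is_condexp (d : measure_display) (T : measurableType d)
    (R : realType) (P : probability T R) (F : set (set T))
    (X Y : T -> R) : Prop :=
  [/\ forall B : set R, measurable B -> F (Y @^-1` B),
      P.-integrable [set: T] (EFin \o Y) &
      forall A : set T, F A ->
        (\int[P]_(w in A) (Y w)%:E = \int[P]_(w in A) (X w)%:E)%E].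

Definition is_condexp_vec (d : measure_display) (T : measurableType d)
    (R : realType) (P : probability T R) (F : set (set T)) (n : nat)
    (X Y : T -> 'cV[R]_n) : Prop :=
  forall i : 'I_n, is_condexp P F (fun w => X w i 0) (fun w => Y w i 0).

Definition measurable_partition (d : measure_display) (T : measurableType d)
    (C : set (set T)) : Prop :=
  partition C id [set: T] /\ C `<=` measurable.

(* Main.v *)
Require Import Defs.
From HB Require Import structures.
From mathcomp Require Import all_boot all_order all_algebra.
From mathcomp Require Import all_classical all_reals all_analysis.
From mathcomp Require Import measurable_realfun.
From mathcomp Require Import ring lra.
Import Order.TTheory GRing.Theory Num.Theory.
Import numFieldNormedType.Exports.
Local Open Scope classical_set_scope.
Local Open Scope ring_scope.

(** Energy increment. For a finite measurable partition let Y be the conditional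
    mean of X, let Z = X - Y and A = E ZZ^T, which equals E XX^T - E YY^T. The
    energy E|Y|^2 lies in [0, 1]. It suffices to find, for every partition, a
    splitting of each cell in two that raises the energy by at least
    |A|_F^2 / 9: if |A|_F^2 > 9 / r held at each of r + 1 successive stages, the
    energy would exceed 1; and 3 <= pi.

    To find the splitting, take a uniformly random sign vector xi, put
    u = A^T xi, and split along the sign s of <u, Z>. If Y' is the new
    conditional mean, then E|<u, Z>| = E s<u, Y' - Y>, which AM-GM bounds by
    |u|^2 / 6 + (3 / 2) E|Y' - Y|^2, and E|Y' - Y|^2 is the energy gain. On
    average over xi, |u|^2 is |A|_F^2, while Khintchine's inequality with the
    constant 1 / sqrt 2 and |Z| <= 2 give
    |A|_F^2 = E <AZ, Z> <= E |AZ| |Z| <= 3 E_xi E |<u, Z>|,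
    as 2 sqrt 2 <= 3. Khintchine's inequality is obtained by the argument of
    Latala and Oleszkiewicz from the Poincare inequality for even functions on
    the discrete cube. *)

(** * Averages over sign vectors, Poincare and Khintchine inequalities *)

Section SignAverages.
Context {R : realType}.
Implicit Types (f g : seq R -> R) (n : nat).

(** Sign vectors are lists, so that induction on [n] peels off the first sign by a mere cons. *)
Fixpoint avg n f : R :=
  if n is m.+1 then
    (avg m (fun x => f (1 :: x)) + avg m (fun x => f (-1 :: x))) / 2
  else f [::].

Lemma eq_avg n f g : f =1 g -> avg n f = avg n g.
Proof.
elim: n f g => [|n IH] f g fg /=; first exact: fg.
by congr ((_ + _) / _); apply: IH => x; exact: fg.
Qed.

Lemma avgD n f g : avg n (fun x => f x + g x) = avg n f + avg n g.
Proof. by elim: n f g => [//|n IH] f g /=; rewrite !IH; field. Qed.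

Lemma avgZ n a f : avg n (fun x => a * f x) = a * avg n f.
Proof. by elim: n f => [//|n IH] f /=; rewrite !IH; field. Qed.

Lemma avg_cst n a : avg n (fun=> a) = a.
Proof. by elim: n => [//|n IH] /=; rewrite !IH; field. Qed.

Lemma avg_sum (I : finType) n (f : I -> seq R -> R) :
  avg n (fun x => \sum_i f i x) = \sum_i avg n (f i).
Proof.
elim: n f => [//|n IH] f /=.
by rewrite !IH -big_split /= mulr_suml.
Qed.

Lemma ler_avg n f g : (forall x, f x <= g x) -> avg n f <= avg n g.
Proof.
elim: n f g => [|n IH] f g fg /=; first exact: fg.
by rewrite ler_pM2r ?invr_gt0 ?ltr0n//; apply: lerD; apply: IH.
Qed.

Lemma avg_le_ex n f : exists x, avg n f <= f x.
Proof.
elim: n f => [|n IH] f /=; first by exists [::].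
have [x px] := IH (fun x => f (1 :: x)).
have [y py] := IH (fun x => f (-1 :: x)).
have [xy|xy] := leP (f (1 :: x)) (f (-1 :: y)).
  by exists (-1 :: y); lra.
by exists (1 :: x); lra.
Qed.

Lemma sqr_avg_le n f : avg n f ^+ 2 <= avg n (fun x => f x ^+ 2).
Proof.
elim: n f => [//|n IH] f /=.
have := IH (fun x => f (1 :: x)); have := IH (fun x => f (-1 :: x)) => /=.
move: (avg n (fun x => f (1 :: x))) (avg n (fun x => f (-1 :: x))) => a b.
by have := sqr_ge0 (a - b); nra.
Qed.

Lemma avg_opp n f : avg n (fun x => f [seq - y | y <- x]) = avg n f.
Proof.
elim: n f => [//|n IH] f /=.
by rewrite opprK (IH (fun x => f (-1 :: x))) (IH (fun x => f (1 :: x))) addrC.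
Qed.

(* The Dirichlet form of the random walk on the discrete cube, that is the
   sum over the coordinates of the average of [D_i f ^+ 2], where [D_i f] is
   half the difference of [f] along the i-th coordinate. *)
Fixpoint dirichlet n f : R :=
  if n is m.+1 then
    (dirichlet m (fun x => f (1 :: x)) + dirichlet m (fun x => f (-1 :: x))) / 2
    + avg m (fun x => ((f (1 :: x) - f (-1 :: x)) / 2) ^+ 2)
  else 0.

Lemma eq_dirichlet n f g : f =1 g -> dirichlet n f = dirichlet n g.
Proof.
elim: n f g => [//|n IH] f g fg /=.
congr ((_ + _) / _ + _); try by apply: IH => x; exact: fg.
by apply: eq_avg => x; rewrite !fg.
Qed.

(** The Dirichlet form is quadratic. This separates the two components of [f] in [poincare_even]. *)
Lemma dirichlet_parallelogram n f g :
  dirichlet n (fun x => f x + g x) + dirichlet n (fun x => f x - g x) =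
  2 * (dirichlet n f + dirichlet n g).
Proof.
elim: n f g => [|n IH] f g /=; first by rewrite !addr0 mulr0.
set a1 := dirichlet n _; set a2 := dirichlet n _; set a3 := avg n _.
set b1 := dirichlet n _; set b2 := dirichlet n _; set b3 := avg n _.
have h1 := IH (fun x => f (1 :: x)) (fun x => g (1 :: x)).
have h2 := IH (fun x => f (-1 :: x)) (fun x => g (-1 :: x)).
rewrite -/a1 -/b1 in h1; rewrite -/a2 -/b2 in h2.
have h3 : a3 + b3 = 2 * (avg n (fun x => ((f (1 :: x) - f (-1 :: x)) / 2) ^+ 2)
    + avg n (fun x => ((g (1 :: x) - g (-1 :: x)) / 2) ^+ 2)).
  by rewrite -!avgD -avgZ; apply: eq_avg => x; field.
lra.
Qed.

(** The variance is the mean of the variances on the two half cubes plus the square of half the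
    difference of their means. By Jensen the latter is at most the new Dirichlet term. *)
Lemma poincare n f :
  avg n (fun x => f x ^+ 2) - avg n f ^+ 2 <= dirichlet n f.
Proof.
elim: n f => [|n IH] f /=; first by rewrite subrr.
have h1 := IH (fun x => f (1 :: x)); have h2 := IH (fun x => f (-1 :: x)).
have h3 := sqr_avg_le n (fun x => (f (1 :: x) - f (-1 :: x)) / 2).
have eq3 : avg n (fun x => (f (1 :: x) - f (-1 :: x)) / 2) =
    (avg n (fun x => f (1 :: x)) - avg n (fun x => f (-1 :: x))) / 2.
  have : 2 * avg n (fun x => (f (1 :: x) - f (-1 :: x)) / 2)
      + avg n (fun x => f (-1 :: x)) = avg n (fun x => f (1 :: x)).
    by rewrite -avgZ -avgD; apply: eq_avg => x; field.
  lra.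
rewrite eq3 in h3; nra.
Qed.

(* An even function has no Walsh coefficient of degree 1, which doubles the
   spectral gap. *)
Lemma poincare_even n f : (forall x, f [seq - y | y <- x] = f x) ->
  2 * (avg n (fun x => f x ^+ 2) - avg n f ^+ 2) <= dirichlet n f.
Proof.
elim: n f => [|n IH] f fE /=; first by rewrite subrr mulr0.
(* On the smaller cube [g] is even, so induction applies. [h] is odd, hence of mean zero: [poincare]
   gives it the constant 1, and the first coordinate contributes the second copy of the mean of
   [h ^+ 2]. *)
pose g x := (f (1 :: x) + f (-1 :: x)) / 2.
pose h x := (f (1 :: x) - f (-1 :: x)) / 2.
have fp x : f (1 :: x) = g x + h x by rewrite /g /h; field.
have fm x : f (-1 :: x) = g x - h x by rewrite /g /h; field.
have fN x : f (1 :: [seq - y | y <- x]) = f (-1 :: x).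
  by rewrite -(fE (-1 :: x)) /= opprK.
have fN' x : f (-1 :: [seq - y | y <- x]) = f (1 :: x).
  by rewrite -(fE (1 :: x)).
have gE x : g [seq - y | y <- x] = g x by rewrite /g fN fN' addrC.
have hE x : h [seq - y | y <- x] = -1 * h x by rewrite /h fN fN'; field.
have h0 : avg n h = 0.
  have := avg_opp n h; rewrite (eq_avg _ _ _ hE) avgZ; lra.
rewrite (eq_dirichlet _ _ _ fp) (eq_dirichlet _ _ _ fm).
rewrite dirichlet_parallelogram.
have -> : avg n (fun x => ((f (1 :: x) - f (-1 :: x)) / 2) ^+ 2) =
  avg n (fun x => h x ^+ 2) by [].
have -> : avg n (fun x => f (1 :: x)) + avg n (fun x => f (-1 :: x)) =
    2 * avg n g.
  by rewrite -avgD -avgZ; apply: eq_avg => x; rewrite /g; field.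
have -> : avg n (fun x => f (1 :: x) ^+ 2) + avg n (fun x => f (-1 :: x) ^+ 2) =
    2 * (avg n (fun x => g x ^+ 2) + avg n (fun x => h x ^+ 2)).
  by rewrite -!avgD -avgZ; apply: eq_avg => x; rewrite /g /h; field.
have := IH g gE; have := poincare n h; rewrite h0.
by rewrite expr0n /=; lra.
Qed.

Definition signed_sum n (b : 'I_n -> R) (x : seq R) : R :=
  \sum_(i < n) x`_i * b i.

Lemma signed_sum_cons n (b : 'I_n.+1 -> R) a x :
  signed_sum _ b (a :: x) = a * b ord0 + signed_sum _ (b \o lift ord0) x.
Proof. by rewrite /signed_sum big_ord_recl. Qed.

(** Distinct signs are orthogonal. The offset [a] absorbs the signs already fixed in the
    induction. *)
Lemma avg_sqr_signed_sum n (b : 'I_n -> R) a :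
  avg n (fun x => (a + signed_sum _ b x) ^+ 2) = a ^+ 2 + \sum_i b i ^+ 2.
Proof.
elim: n b a => [|n IH] b a /=; first by rewrite /signed_sum !big_ord0 !addr0.
under eq_avg do rewrite signed_sum_cons addrA.
rewrite IH; under eq_avg do rewrite signed_sum_cons addrA.
by rewrite IH big_ord_recl /=; field.
Qed.

(* [a + signed_sum b] is affine in each sign and [`|_|] is 1-Lipschitz. *)
Lemma dirichlet_norm_signed_sum n (b : 'I_n -> R) a :
  dirichlet n (fun x => `|a + signed_sum _ b x|) <= \sum_i b i ^+ 2.
Proof.
elim: n b a => [|n IH] b a /=; first by rewrite big_ord0.
rewrite big_ord_recl addrC; apply: lerD.
  rewrite -[leRHS](avg_cst n); apply: ler_avg => x.
  rewrite !signed_sum_cons -[leLHS]real_normK ?num_real//.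
  rewrite -[leRHS]real_normK ?num_real//.
  rewrite lerXn2r ?nnegrE//.
  rewrite normrM normfV (@ger0_norm _ 2)// ler_pdivrMr//.
  apply: (le_trans (ler_dist_dist _ _)).
  have -> : `|b ord0| * 2 = `|b ord0 * 2| by rewrite normrM (@ger0_norm _ 2).
  by rewrite le_eqVlt; apply/orP; left; apply/eqP; congr Num.norm; ring.
rewrite ler_pdivrMr// mulrDr mulr1; apply: lerD.
  apply: le_trans (IH (b \o lift ord0) (a + b ord0)).
  rewrite le_eqVlt; apply/orP; left; apply/eqP; apply: eq_dirichlet => x.
  by rewrite signed_sum_cons mul1r addrA.
apply: le_trans (IH (b \o lift ord0) (a - b ord0)).
rewrite le_eqVlt; apply/orP; left; apply/eqP; apply: eq_dirichlet => x.
by rewrite signed_sum_cons mulN1r addrA.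
Qed.

(** With S the sum of squares and m the mean of the even function [|signed_sum b|], [poincare_even]
    reads 2 (S - m^2) <= S. *)
Lemma khintchine n (b : 'I_n -> R) :
  \sum_i b i ^+ 2 <= 2 * avg n (fun x => `|signed_sum _ b x|) ^+ 2.
Proof.
have even x : `|signed_sum _ b [seq - y | y <- x]| = `|signed_sum _ b x|.
  rewrite -[RHS]normrN /signed_sum -sumrN; congr Num.norm.
  apply: eq_bigr => i _.
  (* Evenness is asked of lists of every length; past the end both sides read the default 0. *)
  have [ix|ix] := ltnP i (size x); first by rewrite (nth_map 0)// mulNr.
  by rewrite !nth_default ?size_map// mul0r oppr0.
have := poincare_even n _ even.
have := dirichlet_norm_signed_sum n b 0.
have := avg_sqr_signed_sum n b 0; rewrite expr0n /= add0r.
under eq_avg do rewrite add0r.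
under eq_dirichlet do rewrite add0r.
under [X in _ -> _ -> 2 * (X - _) <= _ -> _]eq_avg do
  rewrite real_normK ?num_real//.
by move=> ->; lra.
Qed.

End SignAverages.

(** * Expectation of bounded measurable functions *)

Section BoundedMeasurable.
Context {R : realType} {d : measure_display} {T : measurableType d}.
Variable P : probability T R.
Implicit Types f g : T -> R.

(** The bound holds everywhere, not just almost surely: the class is then closed under products, and
    integrability is automatic. *)
Definition bounded_mfun f :=
  measurable_fun [set: T] f /\ exists M, forall w, `|f w| <= M.

Lemma bmf_cst a : bounded_mfun (fun=> a).
Proof. by split; [exact: measurable_cst|exists `|a|]. Qed.

Lemma bmfD f g : bounded_mfun f -> bounded_mfun g ->
  bounded_mfun (fun w => f w + g w).
Proof.
move=> [mf [M fM]] [mg [N gN]]; split; first exact: measurable_funD.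
by exists (M + N) => w; rewrite (le_trans (ler_normD _ _))// lerD.
Qed.

Lemma bmfM f g : bounded_mfun f -> bounded_mfun g ->
  bounded_mfun (fun w => f w * g w).
Proof.
move=> [mf [M fM]] [mg [N gN]]; split; first exact: measurable_funM.
by exists (M * N) => w; rewrite normrM ler_pM.
Qed.

Lemma bmfN f : bounded_mfun f -> bounded_mfun (fun w => - f w).
Proof.
move=> [mf [M fM]]; split; first exact: measurableT_comp.
by exists M => w; rewrite normrN.
Qed.

Lemma bmfX f : bounded_mfun f -> bounded_mfun (fun w => f w ^+ 2).
Proof. by move=> bf; exact: bmfM. Qed.

Lemma bmf_norm f : bounded_mfun f -> bounded_mfun (fun w => `|f w|).
Proof.
move=> [mf [M fM]]; split; first exact: measurableT_comp.
by exists M => w; rewrite normr_id.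
Qed.

Lemma bmf_sum (I : Type) (r : seq I) (F : I -> T -> R) :
  (forall i, bounded_mfun (F i)) -> bounded_mfun (fun w => \sum_(i <- r) F i w).
Proof.
move=> bF; elim: r => [|i r IH].
  by under eq_fun do rewrite big_nil; exact: bmf_cst.
by under eq_fun do rewrite big_cons; exact: bmfD.
Qed.

Lemma bmf_bool (s : T -> bool) (a b : R) : measurable_fun [set: T] s ->
  bounded_mfun (fun w => if s w then a else b).
Proof.
move=> ms; split; first exact: measurable_fun_ifT.
by exists (Num.max `|a| `|b|) => w; case: (s w); rewrite le_max lexx ?orbT.
Qed.

Lemma bmf_avg n (F : seq R -> T -> R) : (forall x, bounded_mfun (F x)) ->
  bounded_mfun (fun w => avg n (fun x => F x w)).
Proof.
elim: n F => [|n IH] F bF /=; first exact: bF.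
by apply: bmfM; [apply: bmfD; apply: IH|exact: bmf_cst].
Qed.

Lemma bmf_integrable f : bounded_mfun f -> P.-integrable [set: T] (EFin \o f).
Proof.
move=> [mf [M fM]]; apply: measurable_bounded_integrable => //.
  by rewrite -ge0_fin_numE// fin_num_measure.
exists M; split; first exact: num_real.
by move=> N MN w _; exact: le_trans (fM w) (ltW MN).
Qed.

Definition Ex f : R := \int[P]_w f w.

Lemma eq_Ex f g : f =1 g -> Ex f = Ex g.
Proof. by move=> /funext ->. Qed.

Lemma Ex_cst a : Ex (fun=> a) = a.
Proof.
by rewrite /Ex Rintegral_cst//= [X in fine X](probability_setT P) mulr1.
Qed.

Lemma ExD f g : bounded_mfun f -> bounded_mfun g ->
  Ex (fun w => f w + g w) = Ex f + Ex g.
Proof. by move=> bf bg; apply: RintegralD => //; exact: bmf_integrable. Qed.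

Lemma ExZ a f : bounded_mfun f -> Ex (fun w => a * f w) = a * Ex f.
Proof. by move=> bf; apply: RintegralZl => //; exact: bmf_integrable. Qed.

Lemma ExB f g : bounded_mfun f -> bounded_mfun g ->
  Ex (fun w => f w - g w) = Ex f - Ex g.
Proof. by move=> bf bg; apply: RintegralB => //; exact: bmf_integrable. Qed.

Lemma Ex_sum (I : Type) (r : seq I) (F : I -> T -> R) :
  (forall i, bounded_mfun (F i)) ->
  Ex (fun w => \sum_(i <- r) F i w) = \sum_(i <- r) Ex (F i).
Proof.
move=> bF; elim: r => [|i r IH].
  by rewrite big_nil; under eq_Ex do rewrite big_nil; exact: Ex_cst.
rewrite big_cons; under eq_Ex do rewrite big_cons.
by rewrite ExD ?IH//; exact: bmf_sum.
Qed.

Lemma ler_Ex f g : bounded_mfun f -> bounded_mfun g ->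
  (forall w, f w <= g w) -> Ex f <= Ex g.
Proof.
by move=> bf bg fg; apply: le_Rintegral => //; exact: bmf_integrable.
Qed.

Lemma Ex_avg n (F : seq R -> T -> R) : (forall x, bounded_mfun (F x)) ->
  Ex (fun w => avg n (fun x => F x w)) = avg n (fun x => Ex (F x)).
Proof.
elim: n F => [//|n IH] F bF /=.
under eq_Ex do rewrite mulrC.
rewrite ExZ; last by apply: bmfD; exact: bmf_avg.
by rewrite ExD ?IH 1?mulrC//; exact: bmf_avg.
Qed.

End BoundedMeasurable.

(* [simple apply] matters: plain [apply] tries to unify the conditional means of
   two distinct labellings by unfolding them, which does not terminate in
   reasonable time. *)
Ltac bmf := intros; lazymatch goal with
  | |- bounded_mfun (fun _ => ?a) => apply bmf_cst
  | |- bounded_mfun (fun w => @?f w + @?g w) => apply (bmfD f g); bmf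
  | |- bounded_mfun (fun w => - @?f w) => apply (bmfN f); bmf
  | |- bounded_mfun (fun w => @?f w * @?g w) => apply (bmfM f g); bmf
  | |- bounded_mfun (fun w => @?f w ^+ 2) => apply (bmfX f); bmf
  | |- bounded_mfun (fun w => `|@?f w|) => apply (bmf_norm f); bmf
  | |- bounded_mfun (fun w => \sum_(i <- ?r) @?F w i) =>
      apply (bmf_sum _ r (fun i w => F w i)); bmf
  | |- bounded_mfun _ => match goal with H : _ |- _ => simple apply H end
  | |- _ => idtac
  end.

(** * Conditional means over finite labellings *)

Section ConditionalMean.
Context {R : realType} {d : measure_display} {T : measurableType d}.
Variable P : probability T R.
Implicit Types (f g : T -> R) (K : finType).
Local Notation Ex := (Ex P).

(** A partition is encoded by a map to a finite type of labels. Empty cells are allowed, and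
    refining a partition is pairing its labels with a bit. *)
Definition measurable_labelling K (c : T -> K) :=
  forall k, measurable (c @^-1` [set k]).

Lemma bmf_cell K (c : T -> K) k : measurable_labelling K c ->
  bounded_mfun (fun w => (c w == k)%:R : R).
Proof.
move=> mc; split; last by exists 1 => w; case: eqP; rewrite ?normr1 ?normr0.
rewrite (_ : (fun w => _) = (\1_(c @^-1` [set k]) : T -> R)).
  by apply: measurable_indic; exact: mc.
apply/funext => w; rewrite indicE; congr (nat_of_bool _)%:R.
by apply/eqP/idP => [cw|/set_mem//]; exact/mem_set.
Qed.

Lemma sum_cells K (c : T -> K) (h : K -> R) w :
  h (c w) = \sum_k h k * (c w == k)%:R.
Proof.
rewrite (bigD1 (c w))//= eqxx mulr1 big1 ?addr0// => k.
by rewrite eq_sym => /negbTE ->; rewrite mulr0.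
Qed.

Lemma bmf_label K (c : T -> K) (h : K -> R) : measurable_labelling K c ->
  bounded_mfun (fun w => h (c w)).
Proof.
move=> mc; rewrite (funext (sum_cells K c h)).
by apply: bmf_sum => k; apply: bmfM; [exact: bmf_cst|exact: bmf_cell].
Qed.

Definition cell_mass K (c : T -> K) k : R := Ex (fun w => (c w == k)%:R).

(* [0] on the cells of zero mass, since there the quotient is [_ / 0]. *)
Definition cell_mean K (c : T -> K) f k : R :=
  Ex (fun w => (c w == k)%:R * f w) / cell_mass K c k.

Definition cmean K (c : T -> K) f w : R := cell_mean K c f (c w).

(** The integral over the cell lies between -M and M times its mass. *)
Lemma Ex_cell0 K (c : T -> K) f k : measurable_labelling K c ->
  bounded_mfun f -> cell_mass K c k = 0 ->
  Ex (fun w => (c w == k)%:R * f w) = 0.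
Proof.
move=> mc bf m0; have [M fM] := bf.2.
have bk := bmf_cell K c k mc.
apply/le_anti/andP; split.
  have -> : 0 = Ex (fun w => M * (c w == k)%:R).
    by rewrite ExZ// -[Ex _]/(cell_mass K c k) m0 mulr0.
  apply: ler_Ex => [||w]; bmf; rewrite mulrC ler_wpM2r//.
  exact: le_trans (ler_norm _) (fM w).
have -> : 0 = Ex (fun w => (- M) * (c w == k)%:R).
  by rewrite ExZ// -[Ex _]/(cell_mass K c k) m0 mulr0.
apply: ler_Ex => [||w]; bmf; rewrite [leRHS]mulrC ler_wpM2r//.
by rewrite lerNl (le_trans _ (fM w))// -normrN ler_norm.
Qed.

Lemma Ex_label K (c : T -> K) (h : K -> R) f : measurable_labelling K c ->
  bounded_mfun f -> Ex (fun w => h (c w) * f w) =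
    \sum_k h k * Ex (fun w => (c w == k)%:R * f w).
Proof.
move=> mc bf; have bk k := bmf_cell K c k mc.
under eq_Ex do rewrite sum_cells mulr_suml.
rewrite Ex_sum; last by move=> k; bmf.
apply: eq_bigr => k _; rewrite -ExZ; last by bmf.
by apply: eq_Ex => w; rewrite mulrA.
Qed.

Lemma bmf_cmean K (c : T -> K) f : measurable_labelling K c ->
  bounded_mfun (cmean K c f).
Proof. exact: bmf_label. Qed.

Lemma Ex_cell_cmean K (c : T -> K) f k : measurable_labelling K c ->
  bounded_mfun f ->
  Ex (fun w => (c w == k)%:R * cmean K c f w)
  = Ex (fun w => (c w == k)%:R * f w).
Proof.
move=> mc bf; have bk := bmf_cell K c k mc.
transitivity (Ex (fun w => cell_mean K c f k * (c w == k)%:R)).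
  by apply: eq_Ex => w; rewrite /cmean; case: eqP => [->|_];
    rewrite ?mul1r ?mulr1 ?mul0r ?mulr0.
rewrite ExZ// -[Ex _]/(cell_mass K c k) /cell_mean.
have [m0|m0] := eqVneq (cell_mass K c k) 0; last by rewrite divfK.
by rewrite m0 mulr0 Ex_cell0.
Qed.

(** The projection property: [f] and its conditional mean agree when tested against functions of the
    label. *)
Lemma Ex_label_cmean K (c : T -> K) (h : K -> R) f : measurable_labelling K c ->
  bounded_mfun f ->
  Ex (fun w => h (c w) * cmean K c f w) = Ex (fun w => h (c w) * f w).
Proof.
move=> mc bf; rewrite !Ex_label//; last exact: bmf_cmean.
by apply: eq_bigr => k _; rewrite Ex_cell_cmean.
Qed.

End ConditionalMean.

Lemma dot_le_signed_sum {R : realType} n (b z : 'I_n -> R) :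
  \sum_i z i ^+ 2 <= 4 ->
  \sum_i b i * z i <= 3 * avg n (fun x => `|signed_sum n b x|).
Proof.
move=> z4; set S := \sum_i _; set a := avg _ _.
have a0 : 0 <= a.
  by rewrite -[0](avg_cst n); apply: ler_avg => x; exact: normr_ge0.
have hk : \sum_i b i ^+ 2 <= 2 * a ^+ 2 := khintchine n b.
(* Cauchy-Schwarz without square roots: t = S and |z|^2 <= 4 give S^2 <= 4 |b|^2, which is at most 8
   a^2 by Khintchine. *)
have sqr_sum t : \sum_i (4 * b i - t * z i) ^+ 2 =
    16 * (\sum_i b i ^+ 2) - 8 * t * (\sum_i b i * z i)
    + t ^+ 2 * \sum_i z i ^+ 2.
  rewrite !mulr_sumr -sumrN -!big_split; apply: eq_bigr => i _ /=; ring.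
have cs : 0 <= \sum_i (4 * b i - S * z i) ^+ 2.
  by apply: sumr_ge0 => i _; exact: sqr_ge0.
have S2 : S ^+ 2 <= (3 * a) ^+ 2.
  have : S ^+ 2 * (\sum_i z i ^+ 2) <= S ^+ 2 * 4.
    by rewrite ler_wpM2l// sqr_ge0.
  rewrite sqr_sum -/S in cs; have := sqr_ge0 a; nra.
have [S0|S0] := leP S 0; first by lra.
by move: S2; rewrite ler_pXn2r// nnegrE; lra.
Qed.

(** * Energy of a labelling and its increase under splitting *)

Section Refinement.
Context {R : realType} {d : measure_display} {T : measurableType d}.
Variable P : probability T R.
Local Notation Ex := (Ex P).
Context {n : nat} {x : 'I_n -> T -> R}.
Hypothesis bx : forall i, bounded_mfun (x i).
Hypothesis x1 : forall w, \sum_i x i w ^+ 2 <= 1.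

Definition energy (K : finType) (c : T -> K) : R :=
  \sum_i Ex (fun w => cmean P K c (x i) w ^+ 2).

Section Labelling.
Context {K : finType} {c : T -> K}.
Hypothesis mc : measurable_labelling K c.

Local Notation y i := (cmean P K c (x i)).
Definition residual i w := x i w - cmean P K c (x i) w.
Local Notation z i := (residual i).

Let by_ i : bounded_mfun (y i). Proof. exact: bmf_cmean. Qed.

Lemma bmf_residual i : bounded_mfun (z i).
Proof. by apply: bmfD => //; exact: bmfN. Qed.
Let bz := bmf_residual.

(** On a cell of positive mass with mean v, |v|^2 is the mean of <v, x>, which is at most (|v|^2 +
    1) / 2. On a null cell v is 0. *)
Lemma cmean_norm_le1 w : \sum_i y i w ^+ 2 <= 1.
Proof.
rewrite /cmean; set k := c w; have [m0|m0] := eqVneq (cell_mass P K c k) 0.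
  by rewrite big1 ?ler01// => i _; rewrite /cell_mean m0 invr0 mulr0 expr0n.
have bk := bmf_cell (R := R) K c k mc.
have mpos : 0 < cell_mass P K c k.
  rewrite lt_neqAle eq_sym m0 /=; apply: Rintegral_ge0 => w' _; exact: ler0n.
set v := fun i => cell_mean P K c (x i) k; rewrite -/(\sum_i v i ^+ 2).
set s := \sum_i _.
have vE i : v i * cell_mass P K c k = Ex (fun w => (c w == k)%:R * x i w).
  by rewrite /v /cell_mean divfK.
have : s * cell_mass P K c k <= (s + 1) / 2 * cell_mass P K c k.
  have -> : s * cell_mass P K c k =
      Ex (fun w => \sum_i v i * ((c w == k)%:R * x i w)).
    rewrite Ex_sum; last by move=> i; bmf.
    rewrite mulr_suml; apply: eq_bigr => i _; rewrite ExZ; last by bmf.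
    by rewrite -vE expr2 mulrA.
  rewrite -ExZ//; apply: ler_Ex => [||w']; bmf.
  case: eqP => _; last by rewrite big1 ?mulr0// => i _; rewrite mul0r mulr0.
  rewrite mulr1.
  have : \sum_i (v i * (1%:R * x i w')) <= \sum_i (v i ^+ 2 + x i w' ^+ 2) / 2.
    by apply: ler_sum => i _; have := sqr_ge0 (v i - x i w'); nra.
  move=> /le_trans; apply; rewrite -mulr_suml big_split /= ler_pM2r//.
  by rewrite lerD2l x1.
by rewrite ler_pM2r//; lra.
Qed.

Lemma energy_ge0 : 0 <= energy K c.
Proof.
by apply: sumr_ge0 => i _; apply: Rintegral_ge0 => w _; exact: sqr_ge0.
Qed.

Lemma energy_le1 : energy K c <= 1.
Proof.
rewrite /energy -Ex_sum; last by move=> i; bmf.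
by rewrite -(Ex_cst P 1); apply: ler_Ex => [||w]; bmf; exact: cmean_norm_le1.
Qed.

Lemma residual_norm_le w : \sum_i z i w ^+ 2 <= 4.
Proof.
have : \sum_i z i w ^+ 2 <= \sum_i (2 * x i w ^+ 2 + 2 * y i w ^+ 2).
  apply: ler_sum => i _; rewrite /residual.
  by have := sqr_ge0 (x i w + y i w); nra.
rewrite big_split -!mulr_sumr /=.
by have := x1 w; have := cmean_norm_le1 w; lra.
Qed.

Lemma Ex_cmean_mul i j :
  Ex (fun w => y i w * x j w) = Ex (fun w => y i w * y j w).
Proof. by symmetry; rewrite /cmean; exact: Ex_label_cmean. Qed.

(** By the projection property both cross terms equal the expectation of [y i * y j]. *)
Lemma Ex_residual_mul i j : Ex (fun w => z i w * z j w) =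
  Ex (fun w => x i w * x j w) - Ex (fun w => y i w * y j w).
Proof.
have -> : Ex (fun w => z i w * z j w) =
    Ex (fun w => (x i w * x j w - y j w * x i w)
               - (y i w * x j w - y i w * y j w)).
  by apply: eq_Ex => w; rewrite /residual; ring.
rewrite !ExB; try by bmf.
rewrite !Ex_cmean_mul subrr subr0; congr (_ - _).
by apply: eq_Ex => w; rewrite mulrC.
Qed.

Section Split.
Context {s : T -> bool}.
Hypothesis ms : measurable_fun [set: T] s.

Definition split_label w : K * bool := (c w, s w).

Lemma measurable_split : measurable_labelling (K * bool)%type split_label.
Proof.
move=> [k b]; have -> : split_label @^-1` [set (k, b)] =
    c @^-1` [set k] `&` s @^-1` [set b].
  by apply/seteqP; split => w; rewrite /split_label /= => -[-> ->].
apply: measurableI; first exact: mc.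
by rewrite -[X in measurable X]setTI; exact: ms.
Qed.
Local Notation y' i := (cmean P (K * bool)%type split_label (x i)).
Let by' i : bounded_mfun (y' i).
Proof. by apply: bmf_cmean => //; exact: measurable_split. Qed.

(** Pythagoras: the coarse mean is a function of the refined label, so its product with the refined
    mean has the expectation of its own square. *)
Lemma energy_split :
  \sum_i Ex (fun w => (y' i w - y i w) ^+ 2) =
  energy (K * bool)%type split_label - energy K c.
Proof.
rewrite /energy -sumrB; apply: eq_bigr => i _.
have cross : Ex (fun w => y i w * y' i w) = Ex (fun w => y i w * y i w).
  rewrite -(Ex_cmean_mul i i) {1 3}/cmean.
  pose h (p : K * bool) := cell_mean P K c (x i) p.1.
  exact: (Ex_label_cmean P _ split_label h (x i) measurable_split (bx i)).
transitivity (Ex (fun w => (y' i w ^+ 2 - y i w * y' i w) -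
    (y i w * y' i w - y i w ^+ 2))).
  by apply: eq_Ex => w; ring.
have b1 : bounded_mfun (fun w => y' i w ^+ 2 - y i w * y' i w) by bmf.
have b2 : bounded_mfun (fun w => y i w * y' i w - y i w ^+ 2) by bmf.
have b3 : bounded_mfun (fun w => y' i w ^+ 2) by bmf.
have b4 : bounded_mfun (fun w => y i w * y' i w) by bmf.
have b5 : bounded_mfun (fun w => y i w ^+ 2) by bmf.
rewrite (ExB P _ _ b1 b2) (ExB P _ _ b3 b4) (ExB P _ _ b4 b5).
rewrite cross.
have -> : Ex (fun w => y i w * y i w) = Ex (fun w => y i w ^+ 2) by [].
by rewrite subrr subr0.
Qed.

(** The sign is a function of the split label, so [x i] may be replaced by its refined mean; AM-GM
    then applies coordinatewise. *)
Lemma split_gain (u : 'I_n -> R) :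
  Ex (fun w => (if s w then 1 else -1) * \sum_i u i * z i w) <=
  (\sum_i u i ^+ 2) / 6 +
  3 / 2 * (energy (K * bool)%type split_label - energy K c).
Proof.
pose sg w : R := if s w then 1 else -1.
have bs : bounded_mfun sg by exact: bmf_bool.
have -> : Ex (fun w => sg w * \sum_i u i * z i w) =
    Ex (fun w => \sum_i u i * (sg w * (y' i w - y i w))).
  under eq_Ex do rewrite mulr_sumr.
  rewrite !Ex_sum; try by move=> i; bmf.
  apply: eq_bigr => i _; rewrite ExZ; last by bmf.
  under eq_Ex do rewrite mulrCA.
  rewrite ExZ; last by bmf.
  congr (_ * _); under eq_Ex do rewrite mulrBr.
  under [RHS]eq_Ex do rewrite mulrBr.
  rewrite !ExB; try by bmf.
  congr (_ - _); symmetry.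
  pose h (p : K * bool) : R := if p.2 then 1 else -1.
  exact: (Ex_label_cmean P _ split_label h (x i) measurable_split (bx i)).
rewrite -energy_split mulr_sumr mulr_suml -big_split /= Ex_sum; last first.
  by move=> i; bmf.
apply: ler_sum => i _; rewrite -ExZ; last by bmf.
rewrite -(Ex_cst P (u i ^+ 2 / 6)) -ExD; try by bmf.
apply: ler_Ex => [||w]; bmf.
have : sg w ^+ 2 = 1 by rewrite /sg; case: (s w); rewrite ?sqrrN expr1n.
move: (sg w) (y' i w - y i w) (u i) => a b v a1.
have := sqr_ge0 (v - 3 * a * b); rewrite sqrrB !exprMn a1; lra.
Qed.

End Split.

Lemma exists_split : exists2 s : T -> bool, measurable_fun [set: T] s &
  (\sum_i \sum_j Ex (fun w => z i w * z j w) ^+ 2) / 9 <=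
  energy (K * bool)%type (@split_label s) - energy K c.
Proof.
pose A i j := Ex (fun w => z i w * z j w).
set e := \sum_i _.
pose u xi j := signed_sum n (fun i => A i j) xi.
pose s xi w := 0 <= \sum_j u xi j * z j w.
have bL xi : bounded_mfun (fun w => \sum_j u xi j * z j w) by bmf.
have ms xi : measurable_fun [set: T] (s xi).
  by apply: measurable_fun_ler; [exact: measurable_cst|exact: (bL xi).1].
pose gain xi := energy (K * bool)%type (@split_label (s xi)) - energy K c.
suff : e / 9 <= avg n gain.
  move=> eg; have [xi gxi] := avg_le_ex n gain.
  by exists (s xi) => //; exact: le_trans gxi.
have avgu : avg n (fun xi => \sum_j u xi j ^+ 2) = e.
  rewrite avg_sum /e exchange_big; apply: eq_bigr => j _ /=.
  have := avg_sqr_signed_sum n (fun i => A i j) 0.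
  by rewrite expr0n add0r => <-; apply: eq_avg => xi; rewrite add0r.
have absL xi : Ex (fun w => `|\sum_j u xi j * z j w|) <=
    (\sum_j u xi j ^+ 2) / 6 + 3 / 2 * gain xi.
  apply: le_trans (split_gain (ms xi) (u xi)).
  rewrite le_eqVlt; apply/orP; left; apply/eqP; apply: eq_Ex => w.
  rewrite /s; case: leP => h; first by rewrite ger0_norm// mul1r.
  by rewrite ltr0_norm// mulN1r.
(* The pairing of A^T xi with z is the signed sum of the coordinates of Az, to which Khintchine
   applies. *)
have swap xi w :
    signed_sum n (fun i => \sum_j A i j * z j w) xi = \sum_j u xi j * z j w.
  rewrite /u /signed_sum; under eq_bigr do rewrite mulr_sumr.
  rewrite exchange_big; apply: eq_bigr => j _; rewrite mulr_suml.
  by apply: eq_bigr => i _; rewrite mulrA.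
have : e <= 3 * avg n (fun xi => Ex (fun w => `|\sum_j u xi j * z j w|)).
  rewrite -Ex_avg; last by move=> xi; bmf.
  have bavg :
      bounded_mfun (fun w => avg n (fun xi => `|\sum_j u xi j * z j w|)).
    by apply: bmf_avg => xi; bmf.
  rewrite -ExZ//.
  have -> : e = Ex (fun w => \sum_i (\sum_j A i j * z j w) * z i w).
    rewrite Ex_sum; last by move=> i; bmf.
    apply: eq_bigr => i _; under [RHS]eq_Ex do rewrite mulr_suml.
    rewrite Ex_sum; last by move=> j; bmf.
    apply: eq_bigr => j _; under [RHS]eq_Ex do rewrite -mulrA.
    rewrite ExZ; last by bmf.
    rewrite expr2; congr (_ * _); apply: eq_Ex => w; exact: mulrC.
  apply: ler_Ex => [||w]; bmf.
  have := dot_le_signed_sum _ _ _ (residual_norm_le w).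
  move=> /(_ (fun i => \sum_j A i j * z j w)) /le_trans; apply.
  by rewrite (eq_avg _ _ _ (fun xi => congr1 _ (swap xi w))).
(* With G the average gain, e <= 3 (e / 6 + (3 / 2) G), that is e / 9 <= G. The weight 1 / 6 in
   [split_gain] is the one giving the best constant. *)
have := ler_avg n _ _ absL; rewrite avgD avgZ.
under [X in X + _]eq_avg do rewrite mulrC.
by rewrite avgZ avgu; lra.
Qed.

End Labelling.

Lemma exists_good_labelling r : (0 < r)%N ->
  exists (K : finType) (c : T -> K),
    [/\ (#|K| <= 2 ^ r)%N, measurable_labelling K c &
      \sum_i \sum_j (Ex (fun w => x i w * x j w) -
        Ex (fun w => cmean P K c (x i) w * cmean P K c (x j) w)) ^+ 2
      <= 9 / r%:R].
Proof.
move=> r0; have rR : 0 < r%:R :> R by rewrite ltr0n.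
pose loss (K : finType) (c : T -> K) :=
  \sum_i \sum_j Ex (fun w => @residual K c i w * @residual K c j w) ^+ 2.
(* While the loss exceeds 9 / r, each split gains more than 1 / r; once it is small the labelling is
   kept. *)
have step j : exists (K : finType) (c : T -> K),
    [/\ (#|K| <= 2 ^ j)%N, measurable_labelling K c &
      loss K c <= 9 / r%:R \/ j%:R / r%:R <= energy K c].
  elim: j => [|j [K [c [Kj mc [small|large]]]]].
  - exists unit, (fun=> tt); split; first by rewrite card_unit.
      move=> []; rewrite (_ : _ @^-1` _ = setT)//; exact/seteqP.
    by right; rewrite mul0r energy_ge0.
  - exists K, c; split => //; last by left.
    by rewrite (leq_trans Kj)// leq_pexp2l.
  have [small|big] := leP (loss K c) (9 / r%:R).
    exists K, c; split => //; last by left.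
    by rewrite (leq_trans Kj)// leq_pexp2l.
  have [s ms gain] := exists_split mc.
  exists (K * bool)%type, (@split_label K c s); split.
  - by rewrite card_prod card_bool expnSr leq_mul2r Kj.
  - exact: measurable_split.
  right; move: gain; rewrite -/(loss K c) -[j.+1%:R]natr1 mulrDl mul1r.
  have : r%:R^-1 < loss K c / 9 by rewrite ltr_pdivlMr// mulrC.
  lra.
have [K [c [Kr mc alt]]] := step r.
exists K, c; split => //.
have -> : \sum_i \sum_j (Ex (fun w => x i w * x j w) -
    Ex (fun w => cmean P K c (x i) w * cmean P K c (x j) w)) ^+ 2 = loss K c.
  by apply: eq_bigr => i _; apply: eq_bigr => j _; rewrite Ex_residual_mul.
(* The energy is already at least 1, so one more split, used only in the argument, cannot gain
   anything and forces the loss to be at most 0. The labelling itself stays within 2^r cells. *)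
case: alt => //; rewrite divff ?gt_eqF// => full.
have [s ms] := exists_split mc.
have := energy_le1 (measurable_split mc ms); rewrite -/(loss K c) => e1 gain.
apply: (@le_trans _ _ 0); last by rewrite divr_ge0.
lra.
Qed.

End Refinement.

(* [sin (pi / 6) = 1 / 2] and [sin x <= x]. *)
Lemma pi_ge3 {R : realType} : 3 <= pi :> R.
Proof.
pose t : R := pi / 6.
have pi0 := pi_gt0 R.
have t0 : 0 < t by rewrite divr_gt0.
have sin3 : sin (t + t + t) = 1.
  by rewrite -sin_pihalf; congr sin; rewrite /t; field.
have s0 : 0 < sin t by apply: sin_gt0_pihalf; rewrite t0 /t /=; lra.
have st : sin t = 1 / 2.
  have := sin3; rewrite !sinD cosD => triple.
  have c2 : cos t ^+ 2 = 1 - sin t ^+ 2 by rewrite -(cos2Dsin2 t) addrK.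
  have : 3 * sin t * cos t ^+ 2 - sin t ^+ 3 = 1 by rewrite -[RHS]triple; ring.
  rewrite c2 => cubic.
  (* The triple-angle equation 3 s - 4 s^3 = 1 in factored form; [sin t] is positive, which leaves 1
     / 2. *)
  have : (sin t + 1) * (2 * sin t - 1) ^+ 2 = 0.
    have -> : (sin t + 1) * (2 * sin t - 1) ^+ 2 =
      1 - (3 * sin t * (1 - sin t ^+ 2) - sin t ^+ 3) by ring.
    by rewrite cubic subrr.
  move/eqP; rewrite mulf_eq0 expf_eq0 /= => /orP[/eqP|/eqP]; lra.
have [c _] : exists2 c, c \in `]0, t[%R & sin t - sin 0 = cos c * (t - 0).
  apply: MVT => //; apply: continuous_subspaceT; exact: continuous_sin.
rewrite sin0 !subr0 st => e.
have : cos c * t <= t by rewrite ler_piMl ?cos_le1// ltW.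
by rewrite -e /t; lra.
Qed.

(** * From labellings to generated sigma-algebras and versions of the conditional expectation *)

Section Transfer.
Context {R : realType} {d : measure_display} {T : measurableType d}.
Variable P : probability T R.
Implicit Types (f g : T -> R).
Local Notation Ex := (Ex P).

Lemma integral_bmf A f : measurable A -> bounded_mfun f ->
  (\int[P]_(w in A) (f w)%:E)%E = (Ex (fun w => (w \in A)%:R * f w))%:E.
Proof.
move=> mA bf.
have bA : bounded_mfun (fun w => (w \in A)%:R : R).
  split; first exact: measurable_indic.
  by exists 1 => w; case: (_ \in _); rewrite ?normr1 ?normr0.
rewrite /Ex /Rintegral fineK.
  rewrite [LHS]integral_mkcond; apply: eq_integral => w _.
  by rewrite patchE; case: ifP; rewrite ?mul1r ?mul0r.
apply: integrable_fin_num => //.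
exact: (bmf_integrable P _ (bmfM _ _ bA bf)).
Qed.

Section Fibres.
Context {K : finType} {c : T -> K}.
Hypothesis mc : measurable_labelling K c.

(** Indexed by points rather than labels, because the parts of a partition must be nonempty. *)
Definition fibres : set (set T) := range (fun w => c @^-1` [set c w]).

Lemma fibres_partition : measurable_partition fibres.
Proof.
split; last by move=> _ [w _ <-]; exact: mc.
split.
- by apply/seteqP; split => // w _; exists (c @^-1` [set c w]) => //; exists w.
- move=> _ _ [w _ <-] [v _ <-] [t [/= cw cv]].
  by rewrite -cw -cv.
- by move=> _ [w _ <-]; exists w.
Qed.

Lemma card_fibres : (fibres #<= `I_#|K|)%card.
Proof.
have sub : fibres `<=` (fun k : 'I_#|K| => c @^-1` [set enum_val k]) @` setT.
  move=> _ [w _ <-]; exists (enum_rank (c w)) => //.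
  by rewrite enum_rankK.
apply: card_le_trans (subset_card_le sub) _.
apply: card_le_trans (card_image_le _ _) _.
have -> : [set: 'I_#|K|] = val @^-1` `I_#|K| by apply/seteqP; split => i //= _.
by apply: card_ge_preimage => i j _ _; exact: val_inj.
Qed.

Lemma fibres_sigma (S : set K) : <<s fibres >> (c @^-1` S).
Proof.
have -> : c @^-1` S = \bigcup_(k in S) c @^-1` [set k].
  by apply/seteqP; split => [w Sw|w [k Sk] /= ->]; first exists (c w).
apply: (@fin_bigcup_measurable _ (g_sigma_algebraType fibres)) => [|k _].
  exact: finite_finset.
have [[w cw]|no] := pselect (exists w, c w = k).
  by apply: sub_sigma_algebra; exists w => //; rewrite cw.
rewrite (_ : c @^-1` [set k] = set0); first exact: sigma_algebra0.
by apply/seteqP; split => w //= cw; apply: no; exists w.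
Qed.

(** The preimages under [c] form a sigma-algebra containing the fibres. *)
Lemma sigma_fibres A : <<s fibres >> A -> exists S : set K, A = c @^-1` S.
Proof.
apply: (@smallest_sub _ (sigma_algebra setT) fibres
  [set A | exists S : set K, A = c @^-1` S]).
  split; first by exists set0; rewrite preimage_set0.
    by move=> B [S ->]; exists (~` S); rewrite setTD preimage_setC.
  move=> F FS; exists [set k | exists i, exists2 w, F i w & c w = k].
  apply/seteqP; split => [w [i _ Fiw]|w /= [i [v Fv cvw]]].
    by exists i, w.
  exists i => //; have [S FiS] := FS i.
  by move: Fv; rewrite FiS /= cvw.
by move=> _ [w _ <-]; exists [set c w].
Qed.

Lemma sigma_fibres_measurable A : <<s fibres >> A -> measurable A.
Proof.
apply: smallest_sub; first exact: sigma_algebra_measurable.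
exact: fibres_partition.2.
Qed.

Section Condexp.
Context {X x : T -> R}.
Hypothesis mX : measurable_fun [set: T] X.
Hypothesis bx : bounded_mfun x.
Hypothesis Xx : {ae P, forall w, X w = x w}.

Lemma ae_eq_integral_truncated A : measurable A ->
  (\int[P]_(w in A) (X w)%:E = \int[P]_(w in A) (x w)%:E)%E.
Proof.
move=> mA; apply: ae_eq_integral => //.
- by apply/measurable_EFinP; exact: measurable_funTS.
- by apply/measurable_EFinP; apply: measurable_funTS; exact: bx.1.
- by apply: filterS Xx => w -> _.
Qed.

Lemma cmean_condexp : is_condexp P <<s fibres >> X (cmean P K c x).
Proof.
have by_ := bmf_cmean P K c x mc.
split=> [B mB||A FA].
- exact: (fibres_sigma (cell_mean P K c x @^-1` B)).
- exact: bmf_integrable.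
have mA := sigma_fibres_measurable _ FA.
rewrite ae_eq_integral_truncated// !integral_bmf//; congr EFin.
have [S ->] := sigma_fibres _ FA.
exact: (Ex_label_cmean P K c (fun k => (k \in S)%:R) x mc bx).
Qed.

Section Version.
Context {Y : T -> R}.
Hypothesis cY : is_condexp P <<s fibres >> X Y.

(** The preimage of a single value of [Y] is a union of fibres, so any version is constant on each
    fibre. *)
Lemma condexp_label : exists h : K -> R, Y = h \o c.
Proof.
have [Ym _ _] := cY.
have const w w' : c w = c w' -> Y w = Y w'.
  move=> cww'.
  have [S YS] := sigma_fibres _ (Ym [set Y w'] (measurable_set1 _)).
  have : (c @^-1` S) w' by rewrite -YS.
  by rewrite /preimage /= -cww' -[S _]/((c @^-1` S) w) -YS.
have /choice [h hP] : forall k, exists a, forall w, c w = k -> Y w = a.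
  move=> k; have [[v cv]|no] := pselect (exists w, c w = k).
    by exists (Y v) => w cw; apply: const; rewrite cw.
  by exists 0 => w cw; case: no; exists w.
by exists h; apply/funext => w /=; exact: hP.
Qed.

Lemma bmf_condexp : bounded_mfun Y.
Proof. by have [h ->] := condexp_label; exact: bmf_label. Qed.

Lemma Ex_label_condexp (h : K -> R) :
  Ex (fun w => h (c w) * Y w) = Ex (fun w => h (c w) * x w).
Proof.
have bY := bmf_condexp.
rewrite !Ex_label//; apply: eq_bigr => k _; congr (_ * _).
have Fk : <<s fibres >> (c @^-1` [set k]) by exact: fibres_sigma.
have [_ _ /(_ _ Fk)] := cY; have mk := mc k.
rewrite ae_eq_integral_truncated// !integral_bmf// => -[].
have inE w : (w \in c @^-1` [set k]) = (c w == k).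
  by apply/idP/eqP => [/set_mem//|cw]; exact/mem_set.
by under eq_Ex do rewrite inE; under [RHS]eq_Ex do rewrite inE.
Qed.

End Version.
End Condexp.

(** Versions may differ from [cmean] on null cells, so the factors are exchanged one at a time, the
    other being a function of the label. *)
Lemma Ex_condexp_mul {X1 X2 x1 x2 Y1 Y2 : T -> R} :
  measurable_fun [set: T] X1 -> measurable_fun [set: T] X2 ->
  bounded_mfun x1 -> bounded_mfun x2 ->
  {ae P, forall w, X1 w = x1 w} -> {ae P, forall w, X2 w = x2 w} ->
  is_condexp P <<s fibres >> X1 Y1 -> is_condexp P <<s fibres >> X2 Y2 ->
  Ex (fun w => Y1 w * Y2 w) =
  Ex (fun w => cmean P K c x1 w * cmean P K c x2 w).
Proof.
move=> mX1 mX2 bx1 bx2 Xx1 Xx2 cY1 cY2.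
have [h1 Y1E] := condexp_label cY1.
transitivity (Ex (fun w => Y1 w * x2 w)).
  by rewrite Y1E; exact: (Ex_label_condexp mX2 bx2 Xx2 cY2 h1).
transitivity (Ex (fun w => Y1 w * cmean P K c x2 w)).
  by rewrite Y1E; symmetry; exact: Ex_label_cmean.
under eq_Ex do rewrite mulrC.
under [RHS]eq_Ex do rewrite mulrC.
transitivity (Ex (fun w => cmean P K c x2 w * x1 w)).
  exact: (Ex_label_condexp mX1 bx1 Xx1 cY1 (cell_mean P K c x2)).
by symmetry; exact: (Ex_label_cmean P K c (cell_mean P K c x2) x1 mc bx1).
Qed.

End Fibres.
End Transfer.

(** * Matrix entries and the final bound *)

Lemma mxexpectation_outer (R : realType) n d (T : measurableType d)
    (P : probability T R) (Y : T -> 'cV[R]_n) i j :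
  mxexpectation P (fun w => Y w *m (Y w)^T) i j =
  Ex P (fun w => Y w i 0 * Y w j 0).
Proof.
rewrite mxE unlock /Ex /Rintegral; congr fine; apply: eq_integral => w _.
by rewrite !mxE big_ord1 !mxE.
Qed.

Lemma normF_sub (R : realType) n (A B : 'M[R]_n) :
  normF (A - B) = Num.sqrt (\sum_i \sum_j (A i j - B i j) ^+ 2).
Proof.
congr Num.sqrt; apply: eq_bigr => i _; rewrite mxE.
by apply: eq_bigr => j _; rewrite !mxE expr2.
Qed.

Theorem corollary5p1 (R : realType) (n : nat) (hn : (0 < n)%N)
    (d : measure_display) (T : measurableType d) (P : probability T R)
    (X : T -> 'cV[R]_n) (mX : random_vector X)
    (X1 : {ae P, forall w, norm2 (X w) <= 1})
    (r : nat) (hr : (0 < r)%N) :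
  exists C : set (set T),
    [/\ measurable_partition C,
        (C #<= `I_(2 ^ r))%card,
        (exists Y : T -> 'cV[R]_n, is_condexp_vec P <<s C >> X Y) &
        forall Y : T -> 'cV[R]_n, is_condexp_vec P <<s C >> X Y ->
          normF (mxexpectation P (fun w => X w *m (X w)^T)
                 - mxexpectation P (fun w => Y w *m (Y w)^T))
          <= pi / Num.sqrt r%:R].
Proof.
(* Setting [X] to 0 on the null event where its norm exceeds 1 makes the bound hold everywhere. *)
pose small w := \sum_i X w i 0 ^+ 2 <= 1.
pose x (i : 'I_n) w := if small w then X w i 0 else 0.
have msum : measurable_fun [set: T] (fun w => \sum_i X w i 0 ^+ 2).
  by apply: measurable_sum => i; apply: measurable_funX; exact: mX.
have msmall : measurable_fun [set: T] small.
  by apply: measurable_fun_ler => //; exact: measurable_cst.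
have x1 w : \sum_i x i w ^+ 2 <= 1.
  have [sm|/negbTE sm] := boolP (small w); rewrite /x sm//.
  by rewrite big1 ?ler01// => i _; rewrite expr0n.
have bx i : bounded_mfun (x i).
  split; first by apply: measurable_fun_ifT => //; exact: mX.
  exists 1 => w; rewrite -(@ler_pXn2r _ 2)// ?nnegrE// expr1n.
  rewrite real_normK ?num_real//.
  apply: le_trans (x1 w); rewrite (bigD1 i)//= lerDl.
  by apply: sumr_ge0 => j _; exact: sqr_ge0.
have Xx : {ae P, forall w, forall i, X w i 0 = x i w}.
  apply: filterS X1 => w Xw i; rewrite /x /small ifT//.
  have s0 : 0 <= \sum_i X w i 0 ^+ 2 by apply: sumr_ge0 => j _; exact: sqr_ge0.
  by rewrite -(sqr_sqrtr s0) expr_le1// sqrtr_ge0.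
have Xxi i : {ae P, forall w, X w i 0 = x i w} by apply: filterS Xx.
have [K [c [Kr mc bound]]] := exists_good_labelling P bx x1 r hr.
exists (fibres (c := c)); split.
- exact: fibres_partition.
- by apply: card_le_trans card_fibres _; rewrite card_le_II.
- exists (fun w => \col_i cmean P K c (x i) w) => i.
  rewrite [Z in is_condexp _ _ _ Z](_ : _ = cmean P K c (x i)).
    exact: (cmean_condexp P mc (mX i) (bx i) (Xxi i)).
  by apply/funext => w; rewrite mxE.
move=> Y cY; rewrite normF_sub.
have -> : pi / Num.sqrt r%:R = Num.sqrt (pi ^+ 2 / r%:R) :> R.
  by rewrite sqrtrM ?sqr_ge0// sqrtr_sqr sqrtrV// ger0_norm// pi_ge0.
apply: ler_wsqrtr.
(* The constant 9 of the energy argument fits because 3 <= pi. *)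
apply: (@le_trans _ _ (9 / r%:R)); last first.
  rewrite ler_wpM2r ?invr_ge0//; have := pi_ge3 (R := R); nra.
apply: le_trans bound; rewrite le_eqVlt; apply/orP; left; apply/eqP.
apply: eq_bigr => i _; apply: eq_bigr => j _; rewrite !mxexpectation_outer.
congr ((_ - _) ^+ 2).
  congr fine; apply: ae_eq_integral => //.
  - by apply/measurable_EFinP; apply: measurable_funM; exact: mX.
  - by apply/measurable_EFinP; apply: measurable_funM; exact: (bx _).1.
  - by apply: filterS Xx => w Xw _; rewrite !Xw.
exact: (Ex_condexp_mul P mc (mX i) (mX j) (bx i) (bx j) (Xxi i) (Xxi j)).
Qed.
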